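(* An improved approximation for the estimation of the distribution function $F_X(v)$, based on Richardson's extrapolation, is $$\hat F_R(v) = g'(x) = \frac{2^{2p_1} G(h) - G(2h)}{2^{2p_1} - 1} + O(h^{2p_2}),$$ where $v=x$, $g$ is the (estimated) left mean absolute deviation function, and $G(h)$ is a difference formula with step size $h$ approximating $g'(x)$, with error exponents $2p_1<2p_2<\cdots$ (see context).
   Context: $X_1,\dots,X_n$ is an i.i.d. random sample from a continuous distribution function $F_X$, with observed values $x_1,\dots,x_n$ and ordered values $x_{(1)}\le\dots\le x_{(n)}$. The left mean absolute deviation function is $\Delta_X^-(v)=E[(v-X)I_{X\le v}]$, where $I$ denotes the indicator function; its derivative in $v$ is $F_X(v)$. It is assumed differentiable at the point considered. Its estimate from the data is $g(x_{(i)})=\frac1n\sum_{j=1}^n (v_i-x_j)I_{x_j\le v_i}$ with $v_i=x_{(i)}$, and $F_X(v)$ is estimated by numerical differentiation of $g$ at $x=v$; $\hat F_R(v)$ denotes the resulting Richardson extrapolation estimator of $F_X(v)$. $G(h)$ is a difference formula with step size $h$ approximating $g'(x)$ as $G(h)=g'(x)+a_1h^{2p_1}+a_2h^{2p_2}+a_3h^{2p_3}+\cdots$, where $p_1<p_2<p_3<\cdots$ and the $a_i$ are constants; $G(2h)$ is the same formula computed with step size $2h$. *)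

(* Defs.v *)
From HB Require Import structures.
From mathcomp Require Export all_boot all_order all_algebra.
From mathcomp Require Export all_classical all_reals all_analysis.
Set Implicit Arguments.
Unset Strict Implicit.
Unset Printing Implicit Defensive.
Export Order.TTheory GRing.Theory Num.Theory.
Export numFieldNormedType.Exports.
Open Scope ring_scope.
Open Scope classical_set_scope.

(* Mutual independence: product rule over every finite subfamily. *)
Definition mutually_independent (R : realType) (d : measure_display)
    (T : measurableType d) (P : probability T R) (n : nat)
    (X : 'I_n -> {RV P >-> R}) : Prop :=
  forall (J : {set 'I_n}) (B : 'I_n -> set R),
    (forall j, measurable (B j)) ->
    P (\bigcap_(j in [set` J]) (X j @^-1` B j)) =
      (\prod_(j in J) P (X j @^-1` B j))%E.

Definition iid_sample (R : realType) (d : measure_display)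
    (T : measurableType d) (P : probability T R) (n : nat)
    (X : 'I_n -> {RV P >-> R}) (F : R -> R) : Prop :=
  mutually_independent X /\ (forall j v, cdf (X j) v = (F v)%:E).

(* Delta_X^-(v) = E[(v - X) 1_{X <= v}], a priori in [0, +oo]. *)
Definition left_mad (R : realType) (d : measure_display)
    (T : measurableType d) (P : probability T R) (X : {RV P >-> R})
    (v : R) : \bar R :=
  'E_P[fun t => (v - X t) * (X t <= v)%R%:R].

(* x_(i+1): indices start at 0. *)
Definition order_stat (R : realType) (n : nat) (x : 'I_n -> R) (i : 'I_n) : R :=
  nth 0 (sort <=%R [seq x j | j <- enum 'I_n]) i.

Definition sample_left_mad (R : realType) (n : nat) (x : 'I_n -> R) (v : R) : R :=
  n%:R^-1 * \sum_(j < n) (v - x j) * (x j <= v)%R%:R.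

(* The data determine g at the ordered observations only. Elsewhere g is left
   free: g may be [sample_left_mad x] itself, which is piecewise linear with
   kinks at the observations, or a smooth interpolation of its values. *)
Definition left_mad_estimate (R : realType) (n : nat) (x : 'I_n -> R)
    (g : R -> R) : Prop :=
  forall i : 'I_n, g (order_stat x i) = sample_left_mad x (order_stat x i).

(* Finite difference formula for g'(x) with nodes x + c_k h and weights
   w_k / h; for example c = (1, -1), w = (1/2, -1/2) is the central one. *)
Definition difference_formula (R : realType) (m : nat) (w c : 'I_m -> R)
    (g : R -> R) (x h : R) : R :=
  (\sum_(k < m) w k * g (x + c k * h)) / h.

(* G(h) = l + a_0 h^(2 p_0) + a_1 h^(2 p_1) + ... as h -> 0+, as an asymptotic
   series: each partial sum is accurate to the order of the first omitted term.
   By Abel summation this also holds, for increasing p, whenever the series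
   converges to G(h) for all small h > 0. *)
Definition error_expansion (R : realType) (G : R -> R) (l : R)
    (a p : nat -> R) : Prop :=
  forall (N : nat) (h : R),
    G h = l + \sum_(i < N) a i * h `^ (2 * p i)
      +O_(h \near 0^'+) (h `^ (2 * p N)).

(* The estimator of F_X(v) with step size h: Richardson extrapolation of a
   difference formula for g'(v) whose leading error exponent is 2 q. *)
Definition richardson_cdf_estimator (R : realType) (m : nat) (w c : 'I_m -> R)
    (g : R -> R) (q v h : R) : R :=
  let G := difference_formula w c g v in
  (2 `^ (2 * q) * G h - G (2 * h)) / (2 `^ (2 * q) - 1).

(* Main.v *)
(* Doubling the step multiplies the leading error term b h^q by 2^q, so
   2^q G(h) - G(2h) cancels it and leaves (2^q - 1) l up to O(h^r); the remainder
   of G(2h) is O((2h)^r) = O(h^r). Apply this with q = 2 p_0 and r = 2 p_1. *)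
Require Import Defs.
From mathcomp Require Import ring lra.

Set Implicit Arguments.
Unset Strict Implicit.
Unset Printing Implicit Defensive.

(** If [Q] holds on (0, e), take h < e / k. With k = 2 this carries the remainder bound from step h
    to step 2h. *)
Lemma near_right0_scale (R : realType) (k : R) (Q : R -> Prop) :
  0 < k -> (\forall h \near 0^'+, Q h) -> \forall h \near 0^'+, Q (k * h).
Proof.
move=> k_gt0 /nbhs_ballP[e /= e_gt0 Qe].
have ek_gt0 : 0 < e / k by rewrite divr_gt0.
near=> h.
have h_gt0 : 0 < h by near: h; exact: nbhs_right_gt.
apply: Qe; last by rewrite mulr_gt0.
rewrite /ball /= sub0r normrN gtr0_norm ?mulr_gt0// mulrC -ltr_pdivlMr//.
Unshelve. all: by end_near. Qed.

Lemma richardson_bigO (R : realType) (G : R -> R) (l b q r : R) :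
  0 < q ->
  (forall h, G h = l + b * h `^ q +O_(h \near 0^'+) (h `^ r)) ->
  forall h, l = (2 `^ q * G h - G (2 * h)) / (2 `^ q - 1)
    +O_(h \near 0^'+) (h `^ r).
Proof.
move=> q_gt0 /funext /eqadd_some_OP/bigO_exP[M [M_gt0 GM]].
apply/funeqP/eqaddOP/bigO_exP.
have GM2 := near_right0_scale (ltr0Sn _ 1) GM.
(* The base 2 is neither 1 nor negative, so a zero divisor would force q = 0. *)
have c_neq0 : 2 `^ q - 1 != 0 :> R.
  by rewrite subr_eq0 powR_eq1 !negb_or gt_eqF ?ltr1n// -leNgt ler0n gt_eqF.
set t : R := 2 `^ q in c_neq0 *.
set s : R := 2 `^ r.
have [t_gt0 s_gt0] : 0 < t /\ 0 < s by rewrite !powR_gt0.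
(* [t * M] bounds the weighted remainder at h and [s * M] the one at 2h, both relative to |h^r|. *)
exists ((t + s) * M / `|t - 1|).
  by rewrite divr_gt0 ?mulr_gt0 ?addr_gt0 ?normr_gt0.
near=> h.
have h_gt0 : 0 < h by near: h; exact: nbhs_right_gt.
have GMh : `|G h - (l + b * h `^ q)| <= M * `|h `^ r| by near: h; exact: GM.
have GM2h : `|G (2 * h) - (l + b * (2 * h) `^ q)| <= M * `|(2 * h) `^ r|.
  by near: h; exact: GM2.
(* The error is exactly a combination of the two remainders: since h > 0, (2h)^q = t h^q, so the
   terms in [b] cancel. *)
have -> : (cst l - (fun h' => (2 `^ q * G h' - G (2 * h')) / (2 `^ q - 1))) h =
  (G (2 * h) - (l + b * (2 * h) `^ q) - t * (G h - (l + b * h `^ q))) / (t - 1).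
  rewrite !fctE powRM ?ler0n ?ltW// -/t /cst.
  by field.
have s_scale : `|(2 * h) `^ r| = s * `|h `^ r|.
  by rewrite powRM ?ler0n ?ltW// normrM (gtr0_norm s_gt0).
rewrite s_scale in GM2h.
rewrite normf_div ler_pdivrMr ?normr_gt0// mulrAC divfK ?normr_eq0//.
rewrite (le_trans (ler_normB _ _))// normrM (gtr0_norm t_gt0).
(* Scaling by [t] beforehand leaves a goal linear in the monomials. *)
have := ler_wpM2l (ltW t_gt0) GMh.
lra.
Unshelve. all: by end_near. Qed.

Theorem theorem6 (R : realType) (d : measure_display) (T : measurableType d)
    (P : probability T R) (FX : R -> R) (X : {RV P >-> R})
    (n : nat) (Xs : 'I_n -> {RV P >-> R}) (omega : T)
    (g : R -> R) (v x : R) (m : nat) (w c : 'I_m -> R)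
    (a p : nat -> R)
    (FX_cont : continuous FX)
    (FX_cdf : forall u, cdf X u = (FX u)%:E)
    (n_gt0 : (0 < n)%N)
    (Xs_iid : iid_sample Xs FX)
    (Delta_fin : forall u, left_mad X u \is a fin_num)
    (Delta_diff : derivable (fun u => fine (left_mad X u)) v 1)
    (g_est : left_mad_estimate (fun j => Xs j omega) g)
    (vx : v = x)
    (g_diff : derivable g x 1)
    (p_gt0 : 0 < p 0%N)
    (p_incr : {homo p : i j / (i < j)%N >-> i < j})
    (G_exp : error_expansion (difference_formula w c g x) ((g^`())%classic x) a p) :
  forall h : R,
    (g^`())%classic x = richardson_cdf_estimator w c g (p 0%N) v h
      +O_(h \near 0^'+) (h `^ (2 * p 1%N)).
Proof.
have p0_gt0 : 0 < 2 * p 0%N by rewrite mulr_gt0.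
rewrite vx /richardson_cdf_estimator.
apply: (richardson_bigO (b := a 0%N)) => // h.
(* N = 1 keeps only the term of index 0, the one to be cancelled; the first omitted exponent is
   [2 * p 1]. *)
have := G_exp 1%N h; rewrite big_ord1.
(* The O-term carries the error function itself, hence a second copy of the sum. *)
by under [X in _ \- X]eq_fun do rewrite big_ord1.
Qed.
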